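(* Let $d$ be a positive integer. For every real number $q\ge 1$ there exists a constant $c>0$ (not depending on $n$) such that for all integers $n\ge 1$, $$\inf_{\tilde K_n}\ \sup_{K\in\mathcal{K}_d^{(1)}}\mathbb{E}_K\left[\mathsf{d}_{\mathsf H}(\tilde K_n,K)^q\right]\ \ge\ c\,n^{-q/d},$$ where the infimum is taken over all set-valued statistics $\tilde K_n=\tilde K_n(X_1,\dots,X_n)$ and, under $\mathbb{E}_K$, the points $X_1,\dots,X_n$ are i.i.d. uniformly distributed in $K$.
   Context: A convex body in $\mathbb{R}^d$ is a compact convex set with nonempty interior. $\mathcal{K}_d^{(1)}$ is the class of all convex bodies in $\mathbb{R}^d$ included in the closed Euclidean unit ball. A set-valued statistic is a map $\tilde K_n$ from $(\mathbb{R}^d)^n$ to the collection of compact subsets of $\mathbb{R}^d$ such that $(x_1,\dots,x_n,x)\mapsto\mathbf{1}[x\in\tilde K_n(x_1,\dots,x_n)]$ is measurable on $(\mathbb{R}^d)^n\times\mathbb{R}^d$; then $\mathsf{d}_{\mathsf H}(\tilde K_n,K)$ is a random variable. $\mathsf{d}_{\mathsf H}$ is the Hausdorff distance with respect to the Euclidean distance (with value $+\infty$ if exactly one of the sets is empty). *)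

(* Defs.v *)
From HB Require Import structures.
From mathcomp Require Import all_boot all_order all_algebra.
From mathcomp Require Import all_classical all_reals all_analysis.
From mathcomp Require Import lra.

Set Implicit Arguments.
Unset Strict Implicit.
Unset Printing Implicit Defensive.

Import Order.TTheory GRing.Theory Num.Theory.
Import numFieldNormedType.Exports.

Local Open Scope classical_set_scope.
Local Open Scope ring_scope.

(* R^d as the row vectors, with the Borel sigma-algebra.  The library topology
   on row vectors is that of the sup norm, hence the Euclidean one. *)
Notation borel_rV R d := (g_sigma_algebraType (@open 'rV[R]_d)).

Section power_measure.
Context dd (T : measurableType dd) (R : realType).

Definition cons_pair n (p : n.-tuple T * T) : n.+1.-tuple T :=
  [tuple of p.2 :: p.1].

Lemma measurable_cons_pair n : measurable_fun [set: n.-tuple T * T] (@cons_pair n).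
Proof. exact: measurable_cons. Qed.

Definition cons_measure n (nu : {measure set (n.-tuple T) -> \bar R})
    (mu : {sigma_finite_measure set T -> \bar R}) :
    set (n.+1.-tuple T) -> \bar R :=
  pushforward (nu \x mu)%E (@cons_pair n).

HB.instance Definition _ n nu mu := Measure.copy (@cons_measure n nu mu)
  (measure_function_pushforward__canonical__measure_function_Measure
     (nu \x mu)%E (@measurable_cons_pair n)).

Fixpoint power_measure (mu : {sigma_finite_measure set T -> \bar R}) n :
    {measure set (n.-tuple T) -> \bar R} :=
  match n with
  | 0 => dirac [tuple]
  | n'.+1 => cons_measure (power_measure mu n') mu
  end.

End power_measure.

Section lebesgue_rV.
Context (R : realType) (d : nat).

Definition row_of_tuple (t : d.-tuple (measurableTypeR R)) : borel_rV R d :=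
  \row_i tnth t i.

Lemma measurable_row_of_tuple :
  measurable_fun [set: d.-tuple (measurableTypeR R)] row_of_tuple.
Proof.
apply: (@measurability _ _ _ (borel_rV R d) _ _ (@open 'rV[R]_d)) => [//|_ [U oU <-]].
pose box (p : {ffun 'I_d -> rat} * nat) : set 'rV[R]_d :=
  [set v | forall i, ball (ratr (p.1 i) : R) p.2.+1%:R^-1 (v ord0 i)].
have -> : U = \bigcup_(p in [set p | box p `<=` U]) box p.
  apply/seteqP; split=> [v Uv|v [p /= pU /pU//]].
  have /nbhs_ballP[e /= e0 veU] : nbhs v U by exact: open_nbhs_nbhs.
  have [k ke] : exists k, k.+1%:R^-1 < e / 2 :> R.
    have [k _ /(_ _ (leqnn k)) ?] :=
      near_infty_natSinv_lt (PosNum (divr_gt0 e0 (@ltr0n R 2))).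
    by exists k.
  have k0 : 0 < k.+1%:R^-1 :> R by rewrite invr_gt0.
  have h i : exists q : rat, ball (ratr q : R) k.+1%:R^-1 (v ord0 i).
    move: k0; set r := _^-1 => r0.
    have /rat_in_itvoo[q] : v ord0 i - r < v ord0 i + r by lra.
    rewrite in_itv/= => /andP[h1 h2]; exists q.
    by rewrite /ball/= ltr_distlC; apply/andP; split; lra.
  have /choice[q qv] := h.
  exists ([ffun i => q i], k); last by move=> i /=; rewrite ffunE.
  move=> w /= bw; apply: veU; split => // a i; rewrite ord1.
  have := bw i; rewrite ffunE => bi.
  by apply: ball_split (le_ball (ltW ke) bi); apply/ball_sym/(le_ball (ltW ke)).
rewrite setTI preimage_bigcup bigcup_mkcond.
apply: countable_bigcupT_measurable => [|p]; first exact: countableP.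
case: ifPn => // _.
have -> : row_of_tuple @^-1` box p =
    \big[setI/setT]_i ((@tnth _ R)^~ i @^-1` ball (ratr (p.1 i) : R) p.2.+1%:R^-1).
  rewrite -bigcap_seq; apply/seteqP; split=> t /= h i.
    by move=> _; have := h i; rewrite /row_of_tuple mxE.
  by have := h i (mem_index_enum _); rewrite /row_of_tuple mxE.
apply: bigsetI_measurable => i _; rewrite -[X in measurable X]setTI.
apply: (@measurable_tnth _ (measurableTypeR R)) => //.
exact: measurable_realfun.measurable_ball.
Qed.

Definition lebesgue_rV : set (borel_rV R d) -> \bar R :=
  pushforward (power_measure (@lebesgue_measure R) d) row_of_tuple.

HB.instance Definition _ := Measure.copy lebesgue_rV
  (measure_function_pushforward__canonical__measure_function_Measure
     (power_measure (@lebesgue_measure R) d) measurable_row_of_tuple).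

End lebesgue_rV.
Arguments lebesgue_rV {R d}.

Section convex_bodies.
Context (R : realType) (d : nat).

Definition euclidean_norm (x : 'rV[R]_d) : R :=
  Num.sqrt (\sum_i x ord0 i ^+ 2).

Definition euclidean_unit_ball : set 'rV[R]_d := [set x | euclidean_norm x <= 1].

Record convex_body := ConvexBody {
  body :> set 'rV[R]_d ;
  body_compact : compact body ;
  body_convex : convex_set body ;
  body_interior : body° !=set0 }.

Lemma measurable_body (K : convex_body) :
  measurable (body K : set (borel_rV R d)).
Proof.
rewrite -[body K]setCK; apply: measurableC; apply: sub_sigma_algebra.
rewrite openC; apply: compact_closed; first exact: norm_hausdorff.
exact: body_compact.
Qed.

(* The normalization of the Lebesgue measure restricted to K; [dirac point] is
   the default value of [mnormalize] for a mass of 0 or +oo, which is not the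
   case of a convex body. *)
Definition uniform_law (K : convex_body) : probability (borel_rV R d) R :=
  mnormalize (mrestr lebesgue_rV (measurable_body K)) (dirac point).

Definition iid_uniform (n : nat) (K : convex_body) :
    {measure set (n.-tuple (borel_rV R d)) -> \bar R} :=
  power_measure (uniform_law K) n.

Definition neighborhood (A : set 'rV[R]_d) (e : R) : set 'rV[R]_d :=
  [set x | exists2 y, A y & euclidean_norm (x - y) <= e].

(* +oo when exactly one of the sets is empty (infimum over the empty set). *)
Definition hausdorff_dist (A B : set 'rV[R]_d) : \bar R :=
  ereal_inf [set e%:E | e in [set e : R |
    [/\ 0 <= e, A `<=` neighborhood B e & B `<=` neighborhood A e]]].

Definition set_statistic (n : nat)
    (Kn : n.-tuple (borel_rV R d) -> set 'rV[R]_d) : Prop :=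
  (forall x, compact (Kn x)) /\
  measurable_fun [set: n.-tuple (borel_rV R d) * borel_rV R d]
    (fun p => \1_(Kn p.1) p.2 : R).

Definition hausdorff_risk (q : R) (n : nat)
    (Kn : n.-tuple (borel_rV R d) -> set 'rV[R]_d) (K : convex_body) : \bar R :=
  (\int[iid_uniform n K]_x (hausdorff_dist (Kn x) K `^ q))%E.

End convex_bodies.

(* Main.v *)
Require Import Defs.
From mathcomp Require Import all_boot all_order all_algebra.
From mathcomp Require Import all_classical all_reals all_analysis.
From mathcomp Require Import borel_hierarchy ring lra.

Set Implicit Arguments.
Unset Strict Implicit.
Unset Printing Implicit Defensive.

Import Order.TTheory GRing.Theory Num.Theory.
Import numFieldNormedType.Exports.
Local Open Scope classical_set_scope.
Local Open Scope ring_scope.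

(** The bound comes from comparing two convex bodies that n points cannot tell
    apart.  Let K0 be the cube [0, a]^d with a = 1/d, and let K1 be K0 with the
    corner at the origin cut off by the half-space where the coordinates sum to
    at least h.  The removed corner lies in [0, h]^d; for h = a (2n)^(-1/d) it
    has at most a fraction 1/(2n) of the volume of K0, so that the uniform law
    of K0 is at least 1 - 1/(2n) times that of K1, and the n-fold power of the
    first is at least (1 - 1/(2n))^n >= 1/2 times that of the second, by
    Bernoulli ([le_iid_uniform]).  The Hausdorff distance between K0 and K1 is of
    order h, that is n^(-1/d): every point of K1 has a coordinate at least h/d,
    whereas K0 contains the origin.  With e = h/(2d), an estimator that
    misses the small cube C = [-e, e]^d is at distance at least e from K0
    ([hausdorff_dist_ge_missed]), and one that meets C is at distance at least e
    from K1 ([hausdorff_dist_ge_hit]).  So the estimator is wrong for K0 on the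
    event where it misses C, and wrong for K1 on the complementary event S; one
    of the two has probability at least 1/2 under K1, hence at least 1/4 under
    the law for which it is an error ([two_point_risk]).

    The delicate point is that S, the set of samples whose estimate meets C, is
    the projection of a measurable subset of a product, and such a projection
    need not be measurable.  It is however a Souslin set: it is obtained by
    Souslin's operation from measurable sets ([souslin_projection] and
    [measurable_souslin]).  For such sets Lusin's capacitability argument gives,
    for every threshold r, either a measurable superset of measure at most r or a
    measurable subset of measure at least r ([souslin_capacitable]).  With r = 1/2
    this replaces the dichotomy above, and bounding the risks from below only
    takes an inequality for possibly non-measurable integrands
    ([ge0_integral_ge]). *)

(** * Functions of finitely many terms of a sequence *)

Section finitary.

(** Continuity towards a discrete space, with a modulus that is uniform in the
    sequence. *)
Definition finitary (A : Type) (f : (nat -> nat) -> A) :=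
  exists m, forall s t, (forall i, (i < m)%N -> s i = t i) -> f s = f t.

Lemma finitary_reindex A (f : (nat -> nat) -> A) (g : nat -> nat) :
  finitary f -> finitary (fun s => f (s \o g)).
Proof.
move=> [m fm]; exists (\max_(l < m) (g l).+1) => s t st; apply: fm => i im /=.
by apply: st; exact: (leq_bigmax (Ordinal im)).
Qed.

Lemma finitary_prefix A (f : nat -> (nat -> nat) -> A) j :
  (forall k, finitary (f k)) ->
  exists m, forall s t, (forall i, (i < m)%N -> s i = t i) ->
    forall k, (k < j)%N -> f k s = f k t.
Proof.
move=> /choice[m fm]; exists (\max_(k < j) m k) => s t st k kj.
apply: fm => i im; apply: st; apply: (leq_trans im).
exact: (leq_bigmax (Ordinal kj)).
Qed.

(** Dependent choice along the finite prefixes of a sequence under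
    construction. *)
Lemma prefix_choice (Q : seq nat -> Prop) :
  Q [::] -> (forall p, Q p -> exists v, Q (rcons p v)) ->
  exists s : nat -> nat, forall m, Q (mkseq s m).
Proof.
move=> Q0 QS.
have /choice[g gQ] p : exists v, Q p -> Q (rcons p v).
  have [/QS[v Qv]|nQ] := pselect (Q p); first by exists v.
  by exists 0%N.
pose p m := iter m (fun p => rcons p (g p)) [::].
have ps m : mkseq (g \o p) m = p m by elim: m => //= m IH; rewrite mkseqS IH.
exists (g \o p) => m; rewrite ps; elim: m => //= m; exact: gQ.
Qed.

Lemma eq_mkseqP (A : eqType) (s t : nat -> A) m :
  mkseq s m = mkseq t m <-> forall i, (i < m)%N -> s i = t i.
Proof.
split=> [st i im|st]; first by rewrite -(nth_mkseq (s 0%N) s im) st nth_mkseq.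
by apply/eq_in_map => i; rewrite mem_iota add0n => /andP[_]; exact: st.
Qed.

(** Koenig's lemma, which is the compactness of the box of sequences below [b]:
    conditions that each look at finitely many terms and are finitely
    satisfiable in the box are satisfiable together. *)
Lemma bounded_branch (H : nat -> (nat -> nat) -> Prop) (b : nat -> nat) :
  (forall k, finitary (H k)) ->
  (forall j, exists s, (forall i, (s i <= b i)%N) /\
                       forall k, (k < j)%N -> H k s) ->
  exists s, (forall i, (s i <= b i)%N) /\ forall k, H k s.
Proof.
move=> fH HT.
pose T j s := (forall i, (s i <= b i)%N) /\ forall k, (k < j)%N -> H k s.
pose Q p := forall j, exists s, T j s /\ mkseq s (size p) = p.
have [j|p Qp|s Qs] := @prefix_choice Q.
- by have [s Ts] := HT j; exists s.
- apply: contrapT => /forallNP nQ.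
  (* If each of the finitely many next terms fails at some stage j v, then all
     of them fail at the largest of these stages. *)
  have /choice[j jP] v : exists j, forall s, T j s -> mkseq s (size p) = p ->
      s (size p) <> v.
    have /existsNP[j jN] := nQ v; exists j => s Ts sp sv; apply: jN.
    by exists s; rewrite size_rcons mkseqS sp sv.
  have [s [[sb sH] sp]] := Qp (\max_(v < (b (size p)).+1) j v).
  apply: (jP (s (size p)) s) => //; split => // k kj; apply: sH.
  have vb : (s (size p) < (b (size p)).+1)%N by rewrite ltnS.
  exact: leq_trans kj (leq_bigmax (Ordinal vb)).
exists s; split=> [i|k].
  have [t [[tb _]]] := Qs i.+1 0%N; rewrite size_mkseq => /eq_mkseqP <- //.
have [m Hm] := fH k; have [t [[_ tH]]] := Qs m k.+1.
by rewrite size_mkseq => /eq_mkseqP ts; rewrite -(Hm t s ts); exact: tH.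
Qed.

End finitary.

(** * Souslin sets *)

Section souslin.
Context (Z : Type).
Implicit Types (P : set_system Z) (E : set Z).

(** Souslin's operation applied to a scheme of sets of [P].  A scheme is usually
    indexed by finite sequences; letting the k-th set depend on a bounded number
    of terms of [s] instead of exactly k of them makes unions and intersections a
    mere reindexing. *)
Definition souslin P E := exists H : nat -> (nat -> nat) -> set Z,
  [/\ forall k s, P (H k s), forall k, finitary (H k) &
      E = [set z | exists s, forall k, H k s z]].

Lemma souslin_base P E : P E -> souslin P E.
Proof.
move=> PE; exists (fun _ _ => E); split => // [k|]; first by exists 0%N.
by apply/seteqP; split=> z /=; [move=> Ez; exists id|case=> _ /(_ 0%N)].
Qed.

Let pair_of (k : nat) : nat * nat := odflt (0, 0)%N (unpickle k).

Let pair_ofK p : pair_of (pickle p) = p.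
Proof. by rewrite /pair_of pickleK. Qed.

(** The first term of the sequence chooses the index of the set, and the other
    terms serve as the sequence for that set; [setT] stands for the conditions
    of the sets that are not chosen. *)
Lemma souslin_bigcup P (E : (set Z)^nat) : P setT ->
  (forall n, souslin P (E n)) -> souslin P (\bigcup_n E n).
Proof.
move=> PT /choice[H /all_and3[PH fH EH]].
pose G ij (s : nat -> nat) :=
  if s 0%N == ij.1 then H ij.1 ij.2 (s \o succn) else setT.
exists (G \o pair_of); split=> [k s|k|].
- by rewrite /G /=; case: ifP.
- have [m Hm] := finitary_reindex succn (fH (pair_of k).1 (pair_of k).2).
  exists m.+1 => s t st; rewrite /G/= st//; case: ifP => // _.
  by apply: Hm => i im; apply: st; rewrite (leq_trans im).
apply/seteqP; split=> [z [n _]|z [s Gs]].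
  rewrite EH => -[s Hs]; exists (fun i => if i is j.+1 then s j else n) => k.
  by rewrite /G/=; case: eqP => //= <-; exact: Hs.
exists (s 0%N) => //; rewrite EH; exists (s \o succn) => k.
by have := Gs (pickle (s 0%N, k)); rewrite /G/= pair_ofK/= eqxx.
Qed.

(** One sequence codes countably many, through a pairing of the integers. *)
Lemma souslin_bigcap P (E : (set Z)^nat) :
  (forall n, souslin P (E n)) -> souslin P (\bigcap_n E n).
Proof.
move=> /choice[H /all_and3[PH fH EH]].
pose col (i : nat) (s : nat -> nat) := s \o (fun j : nat => pickle (i, j)).
pose G ij (s : nat -> nat) := H ij.1 ij.2 (col ij.1 s).
exists (G \o pair_of); split=> [k s|k|]; first exact: PH.
  exact/finitary_reindex.
apply/seteqP; split=> [z Ez|z [s Gs] n _].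
  have /choice[s Hs] n : exists s, forall k, H n k s z.
    by have := Ez n I; rewrite EH.
  exists (fun l => s (pair_of l).1 (pair_of l).2) => k; rewrite /G/=.
  rewrite [X in H _ _ X](_ : _ = s (pair_of k).1)//.
  by apply/funext => j; rewrite /col/= pair_ofK.
rewrite EH; exists (col n s) => k.
by have := Gs (pickle (n, k)); rewrite /G/= pair_ofK.
Qed.

End souslin.

(** * Capacitability of Souslin sets *)

Section capacitability.
Local Open Scope ereal_scope.
Context d (X : measurableType d) (R : realType).
Variable P : {measure set X -> \bar R}.
Hypothesis finP : P setT < +oo.

(** That is, the outer measure of [A] is at most [r]. *)
Let small (r : \bar R) (A : set X) :=
  exists B, [/\ measurable B, A `<=` B & P B <= r].

(** Continuity from below of the outer measure along increasing sets, which need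
    not be measurable. *)
Lemma outer_bound_bigcup r (A : (set X)^nat) :
  (forall m n, (m <= n)%N -> A m `<=` A n) ->
  (forall n, small r (A n)) -> small r (\bigcup_n A n).
Proof.
move=> ndA /choice[B /all_and3[mB AB PB]].
pose C n := \bigcap_(j in [set j | (n <= j)%N]) B j.
have mC n : measurable (C n) by apply: bigcap_measurableType.
have mUC : measurable (\bigcup_n C n) by exact: bigcupT_measurable.
(* The tails C n of the supersets still contain A n, and they increase. *)
exists (\bigcup_n C n); split => //.
  by move=> x [n _ Anx]; exists n => // j /= nj; exact/AB/(ndA n).
have ndC : nondecreasing_seq C.
  move=> m n mn; apply/subsetPset => x Cx j /= nj; apply: Cx.
  exact: leq_trans mn nj.
have /cvg_lim <- := nondecreasing_cvg_mu (mu := P) mC mUC ndC => //.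
apply: lime_le.
  by apply/cvg_ex; eexists; exact: (nondecreasing_cvg_mu (mu := P) mC mUC ndC).
apply: nearW => n /=; apply: le_trans (PB n).
by apply: le_measure; rewrite ?inE// => x; apply => /=.
Qed.

(** Suppose that [S] has outer measure above [r].  By continuity from below,
    bounds b 0, b 1, ... can be chosen one after the other so that restricting
    the first m terms of the sequence to lie below [b] keeps the outer measure
    above [r], for every m.  The set [G j] of the points that satisfy the first j
    conditions for some sequence below [b] is measurable, as these conditions
    look at finitely many terms, and it contains one of the previous restrictions.
    So it has measure above [r], and so has the decreasing intersection of the
    [G j], up to equality.  By Koenig's lemma this intersection lies in [S]. *)
Lemma souslin_capacitable r S : souslin measurable S ->
  (exists B, [/\ measurable B, S `<=` B & P B <= r]) \/
  (exists F, [/\ measurable F, F `<=` S & r <= P F]).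
Proof.
move=> [H [mH fH ->]]; set S' := [set _ | _].
have [|nS] := pselect (small r S'); [by left|right].
pose below (p : seq nat) := [set x | exists s,
  (forall i, (i < size p)%N -> (s i <= nth 0 p i)%N) /\ forall k, H k s x].
have [nS0|p np|b nb] := @prefix_choice (fun p => ~ small r (below p)).
- apply: nS; have [B [mB SB PB]] := nS0; exists B; split => //.
  by apply: subset_trans SB => x [s Hs]; exists s.
- apply: contrapT => /forallNP/(_ _)/contrapT sv; apply: np.
  have nd m n : (m <= n)%N -> below (rcons p m) `<=` below (rcons p n).
    move=> mn x [s [sp Hs]]; exists s; split => // i.
    rewrite size_rcons ltnS leq_eqVlt.
    have := sp i; rewrite size_rcons ltnS leq_eqVlt !nth_rcons.
    case: ltngtP => //= _ h _; exact: leq_trans (h isT) mn.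
  have [B [mB SB PB]] := outer_bound_bigcup nd sv.
  exists B; split => //; apply: subset_trans SB => x [s [sp Hs]].
  exists (s (size p)) => //; exists s; split => // i.
  rewrite size_rcons ltnS nth_rcons; case: ltngtP => // [+ _|->//].
  exact: sp.
pose G j := [set x | exists s, (forall i, (s i <= b i)%N) /\
                               forall k, (k < j)%N -> H k s x].
have mG j : measurable (G j).
  have [m Hm] := finitary_prefix j fH.
  have -> : G j = \bigcup_(u : seq nat)
      if `[< forall i, (nth 0 u i <= b i)%N >]
      then \bigcap_(k in `I_j) H k (nth 0%N u) else set0.
    apply/seteqP; split=> [x [s [sb Hs]]|x [u _]].
      exists (mkseq s m) => //; rewrite ifT => [k /= kj|].
        rewrite (Hm _ s)//; first exact: Hs.
        by move=> i im; rewrite nth_mkseq.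
      apply/asboolP => i; have [im|mi] := ltnP i m; first by rewrite nth_mkseq.
      by rewrite nth_default// size_mkseq.
    case: ifPn => [/asboolP ub Hu|//].
    by exists (nth 0%N u); split => // k kj; exact: Hu.
  apply: countable_bigcupT_measurable => [|u]; first exact: countableP.
  by case: ifP => // _; exact: bigcap_measurableType.
have rG j : r <= P (G j).
  rewrite leNgt; apply/negP => /ltW Gr; have [m Hm] := finitary_prefix j fH.
  apply: (nb m); exists (G j); split => // x [s [sb Hs]].
  exists (fun i => if (i < m)%N then s i else 0%N); split=> [i|k kj].
    case: ifPn => // im; have := sb i; rewrite size_mkseq nth_mkseq//.
    exact.
  by rewrite (Hm _ s)// => i ->.
have niG : nonincreasing_seq G.
  move=> i j ij; apply/subsetPset => x [s [sb Hs]]; exists s; split => // k ki.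
  exact/Hs/(leq_trans ki).
have mF : measurable (\bigcap_j G j) by exact: bigcapT_measurable.
exists (\bigcap_j G j); split => //.
  move=> x Gx; have [k|j|s [_ Hs]] := @bounded_branch (fun k s => H k s x) b.
  - by have [m Hm] := fH k; exists m => s t st; rewrite (Hm _ _ st).
  - exact: Gx.
  - by exists s.
have cG : P \o G @ \oo --> P (\bigcap_j G j).
  apply: nonincreasing_cvg_mu => //.
  by apply: le_lt_trans finP; apply: le_measure; rewrite ?inE.
rewrite -(cvg_lim _ cG)//; apply: lime_ge; last exact: nearW.
by apply/cvg_ex; eexists; exact: cG.
Qed.

End capacitability.

(** * Projections of measurable sets along a compact set *)

(** The closed sets are those of the points at distance at least 1/(m+1) from
    the complement. *)
Lemma open_Fsigma (R : realType) (Y : pseudoMetricType R) (U : set Y) :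
  open U -> Fsigma U.
Proof.
move=> oU; pose K m := \bigcap_(z in ~` U) ~` (ball z m.+1%:R^-1)°.
exists K => [m|].
  by apply: closed_bigI => z _; apply: open_closedC; exact: open_interior.
apply/seteqP; split=> [y Uy|y [m _ Ky]]; last first.
  apply: contrapT => nUy; apply: (Ky y nUy).
  by apply: nbhsx_ballx; rewrite invr_gt0.
have /nbhs_ballP[e /= e0 yeU] : nbhs y U by exact: open_nbhs_nbhs.
have [m _ /(_ _ (leqnn m)) me] := near_infty_natSinv_lt (PosNum e0).
exists m => // z nUz /interior_subset /= zy; apply: nUz; apply: yeU.
exact/ball_sym/(le_ball (ltW me)).
Qed.

Section projection.
Context d (X : measurableType d).

Definition rectangle (Y : topologicalType) : set_system (X * Y) :=
  [set A `*` K | A in measurable & K in closed].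

Lemma rectangleT (Y : topologicalType) : @rectangle Y setT.
Proof.
exists setT; first exact: measurableT.
by exists setT; [exact: closedT|rewrite setXTT].
Qed.

(** By compactness of [C] and closedness of the rectangles in the second
    variable, a point y of [C] satisfying all conditions exists as soon as the
    finitely many conditions below any j can be satisfied.  The projection of
    finitely many rectangles is measurable, so these finite projections form a
    Souslin scheme for the projection. *)
Lemma souslin_projection (Y : ptopologicalType) (C : set Y) (E : set (X * Y)) :
  compact C -> souslin (@rectangle Y) E ->
  souslin measurable [set x | exists2 y, C y & E (x, y)].
Proof.
move=> cC [H [rH fH ->]].
have {rH}/choice[A /choice[K AK]] k :
    exists A, exists K : (nat -> nat) -> set Y, forall s,
      [/\ measurable (A s), closed (K s) & H k s = A s `*` K s].
  have /choice[A /choice[K AK]] s : exists A, exists K,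
      [/\ measurable A, closed K & H k s = A `*` K].
    by have [A mA [K cK <-]] := rH k s; exists A, K.
  by exists A, K.
exists (fun j s =>
  [set x | exists2 y, C y & forall k, (k < j)%N -> H k s (x, y)]).
split=> [j s|j|].
- (* If the closed sides of the rectangles have a common point in C, then the
     projection is the intersection of the other sides; otherwise it is empty. *)
  have [[y [Cy Ky]]|nK] := pselect (exists y, C y /\
      forall k, (k < j)%N -> K k s y).
    rewrite (_ : [set _ | _] = \bigcap_(k in `I_j) A k s).
      by apply: bigcap_measurableType => k _; have [] := AK k s.
    apply/seteqP; split=> [x [z Cz Hz] k /= kj|x Ax].
      by have := Hz k kj; have [_ _ ->] := AK k s; case.
    by exists y => // k kj; have [_ _ ->] := AK k s; split; [exact: Ax|
      exact: Ky].
  rewrite (_ : [set _ | _] = set0)//; apply/seteqP; split=> // x [y Cy Hy].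
  apply: nK; exists y; split => // k kj.
  by have := Hy k kj; have [_ _ ->] := AK k s; case.
- have [m Hm] := finitary_prefix j fH; exists m => s t st.
  apply/seteqP; split=> x [y Cy Hy]; exists y => // k kj.
    by rewrite -(Hm _ _ st)//; exact: Hy.
  by rewrite (Hm _ _ st)//; exact: Hy.
apply/seteqP; split=> [x [y Cy [s Hs]]|x [s Hs]].
  by exists s => j; exists y.
have HC : closed_fam_of C setT (fun k => C `&` [set y | H k s (x, y)]).
  exists (fun k => [set y | H k s (x, y)]) => // k _.
  have [_ cK ->] := AK k s; have [Ax|nAx] := pselect (A k s x).
    rewrite (_ : [set _ | _] = K k s)//.
    by apply/seteqP; split=> y //= [].
  rewrite (_ : [set _ | _] = set0); first exact: closed0.
  by apply/seteqP; split=> y //= [].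
move: cC; rewrite compact_In0 => /(_ nat setT _ HC)[D' _|y Hy].
  have [y Cy Hy] := Hs (\max_(k <- finmap.enum_fset D') k.+1).
  exists y => k kD; split => //=.
  by apply: Hy; exact: (@leq_bigmax_seq _ _ xpredT (fun k => k.+1)).
by exists y; [have [] := Hy 0%N I|exists s => k; have [] := Hy k I].
Qed.

(** The sets that are Souslin together with their complement form a
    sigma-algebra, and it contains the cylinders over measurable sets and over
    open sets. *)
Lemma measurable_souslin (Y : ptopologicalType)
    (E : set (X * g_sigma_algebraType (@open Y))) :
  (forall U : set Y, open U -> Fsigma U) -> measurable E ->
  souslin (@rectangle Y) E.
Proof.
move=> FsigmaY; pose G : set_system (X * Y) :=
  [set E | souslin (@rectangle Y) E /\ souslin (@rectangle Y) (~` E)].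
suff : (measurable : set_system (X * g_sigma_algebraType (@open Y))) `<=` G.
  by move=> /[apply] -[].
have GC E' : G E' -> G (~` E') by rewrite /G/= setCK => -[].
have sG : sigma_algebra setT G.
  split=> [|E'|F GF].
  - rewrite -setCT; apply: GC; rewrite /G/= setCT; split.
      exact/souslin_base/rectangleT.
    apply/souslin_base; exists set0 => //.
    by exists setT; [exact: closedT|rewrite set0X].
  - by rewrite setTD; exact: GC.
  - split; last by rewrite setC_bigcup; apply: souslin_bigcap => n; case: (GF n).
    by apply: souslin_bigcup => [|n]; [exact: rectangleT|case: (GF n)].
apply: smallest_sub => // _ [[A mA <-]|[B mB <-]]; rewrite setTI.
  have rect A' : measurable A' -> souslin (@rectangle Y) (fst @^-1` A').
    move=> mA'; apply: souslin_base; exists A' => //.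
    by exists setT; [exact: closedT|rewrite setXT].
  by split; [exact: rect|rewrite preimage_setC; exact/rect/measurableC].
have rect K : closed K -> souslin (@rectangle Y) (snd @^-1` K).
  by move=> cK; apply: souslin_base; exists setT => //; exists K => //;
    rewrite setTX.
suff : preimage_set_system setT snd
    (@measurable _ (g_sigma_algebraType (@open Y))) `<=` G.
  by move=> /(_ (snd @^-1` B)); apply; exists B => //; rewrite setTI.
rewrite -g_sigma_preimageE; apply: smallest_sub => // _ [U oU <-].
rewrite setTI; split; last by rewrite preimage_setC; exact/rect/open_closedC.
have [K cK ->] := FsigmaY _ oU; rewrite preimage_bigcup.
by apply: souslin_bigcup => [|n]; [exact: rectangleT|exact/rect].
Qed.

End projection.

(** * Integrals, powers of measures and cubes *)

Section lower_integral.
Local Open Scope ereal_scope.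
Import HBNNSimple.
Context d (T : measurableType d) (R : realType) (mu : {measure set T -> \bar R}).

(** A form of Markov's inequality that holds for non-measurable [f], as the
    integral of a nonnegative function is the supremum of those of the simple
    functions below it. *)
Lemma ge0_integral_ge (f : T -> \bar R) (v : R) (A : set T) :
  (0 <= v)%R -> measurable A -> (forall x, 0 <= f x) ->
  (forall x, A x -> v%:E <= f x) -> v%:E * mu A <= \int[mu]_x f x.
Proof.
move=> v0 mA f0 vf; rewrite ge0_integralTE//.
pose h := scale_nnsfun (indic_nnsfun R mA) v0.
have hE x : h x = (v * \1_A x)%R by [].
apply: ereal_sup_ubound; exists h => [x|].
  rewrite hE indicE; have [/[!inE] xA|xA] := boolP (x \in A).
    by rewrite mulr1; exact: vf.
  by rewrite mulr0.
rewrite -integralT_nnsfun; under eq_integral do rewrite hE.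
rewrite (integralZl_indic measurableT (fun=> A))// => [|v1].
  by rewrite integral_indic// setIT.
by have := le_lt_trans v0 v1; rewrite ltxx.
Qed.

End lower_integral.

Section power_measure_theory.
Local Open Scope ereal_scope.
Context dd (T : measurableType dd) (R : realType).
Implicit Types mu : {sigma_finite_measure set T -> \bar R}.

Lemma power_measure_cube mu n (I : set T) : measurable I ->
  power_measure mu n [set t | forall i, I (tnth t i)] = (mu I ^+ n)%E.
Proof.
move=> mI; elim: n => [|n IH].
  by rewrite expe0 [LHS]diracE mem_set//= => -[].
rewrite expeS.
have mcube : measurable [set t : n.-tuple T | forall i, I (tnth t i)].
  rewrite [X in measurable X](_ : _ = \bigcap_(i : 'I_n) ((@tnth _ _)^~ i @^-1` I)).
    by apply: fin_bigcap_measurable => // i _; rewrite -[X in measurable X]setTI;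
      exact: measurable_tnth.
  by apply/seteqP; split=> t h i //=; exact: h.
rewrite /= /cons_measure /pushforward [X in product_measure1 _ _ X](_ : _ =
    [set t : n.-tuple T | forall i, I (tnth t i)] `*` I).
  by rewrite product_measure1E// IH muleC.
apply/seteqP; split=> [[t x] h|[t x] [/= h Ix] i]; last first.
  case: (unliftP ord0 i) => [j|] ->; first by rewrite tnthS; exact: h.
  by rewrite tnth0.
split=> /=; last by have := h ord0; rewrite tnth0.
by move=> i; have := h (lift ord0 i); rewrite tnthS.
Qed.

Lemma power_measure_total mu n : mu setT = 1 -> power_measure mu n setT = 1.
Proof.
move=> mu1; have := power_measure_cube mu n (@measurableT _ T).
rewrite mu1 -EFin_expe expr1n => <-; congr (power_measure _ _ _).
by apply/seteqP; split.
Qed.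

(** By Fubini, one factor at a time: first the density bound for the new factor,
    inside the integral, then the one for the previous factors. *)
Lemma le_power_measure mu0 mu1 (c : R) : (0 <= c)%R ->
  (forall A, measurable A -> c%:E * mu1 A <= mu0 A) ->
  forall n A, measurable A ->
    (c ^+ n)%:E * power_measure mu1 n A <= power_measure mu0 n A.
Proof.
move=> c0 mu01; elim=> [|n IH] A mA /=; first by rewrite expr0 mul1e.
rewrite /cons_measure /pushforward /=.
set B := _ @^-1` A.
have mB : measurable B.
  by rewrite -[B]setTI; exact: measurable_cons_pair.
rewrite /product_measure1.
have k0 : (0 <= c ^+ n)%R by exact: exprn_ge0.
have := ge0_integral_mscale (power_measure mu1 n) measurableT (NngNum k0)
  (measurable_fun_xsection mu1 mB) (fun _ _ => measure_ge0 _ _).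
move=> /= scaleE.
rewrite exprSr EFinM -muleA muleCA -scaleE -ge0_integralZl//; last first.
  exact: measurable_fun_xsection.
have mcB := measurable_funeM c%:E (measurable_fun_xsection mu1 mB).
apply: (@le_trans _ _ (\int[power_measure mu0 n]_x (c%:E * (mu1 \o xsection B) x))).
  apply: ge0_le_measure_integral => // x; exact: mule_ge0.
apply: ge0_le_integral => //.
- by move=> x _; exact: mule_ge0.
- exact: measurable_fun_xsection.
- by move=> x _; apply: mu01; exact: measurable_xsection.
Qed.

End power_measure_theory.

Section cube.
Context (R : realType) (d : nat).

(** With bounds 0 and a this is the larger of the two bodies to be compared; with
    bounds -e and e, the region near the origin where the estimate is tested. *)
Definition cube (a b : R) : set 'rV[R]_d :=
  [set v | forall i, a <= v ord0 i <= b].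

Lemma compact_cube a b : compact (cube a b).
Proof.
rewrite (_ : cube a b = [set v | forall i, `[a, b]%classic (v ord0 i)]).
  by apply: (@rV_compact R d (fun=> `[a, b]%classic)) => i; exact: segment_compact.
by apply/seteqP; split=> v /= h i; have := h i; rewrite in_itv.
Qed.

Lemma lebesgue_cube a : 0 <= a -> lebesgue_rV (cube 0 a) = (a ^+ d)%:E.
Proof.
move=> a0; rewrite /lebesgue_rV/= /pushforward.
rewrite [X in power_measure _ _ X](_ : _ =
    [set t | forall i, [set` `[0, a]] (tnth t i)]).
  transitivity ((lebesgue_measure (`[0%R, a]%classic : set R)) ^+ d)%E.
    exact: power_measure_cube.
  rewrite lebesgue_measure_itv/= lte_fin; case: ltgtP a0 => //= [a0 _|<- _].
    by rewrite sube0 EFin_expe.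
  by rewrite EFin_expe.
by apply/seteqP; split=> t /= h i; have := h i; rewrite mxE/= in_itv.
Qed.

End cube.

(** * Lower bounds for the Hausdorff distance and the risk *)

Section hausdorff.
Context (R : realType) (d : nat).
Implicit Types (A B : set 'rV[R]_d) (e : R).

Lemma coord_le_norm (x : 'rV[R]_d) i : `|x ord0 i| <= euclidean_norm x.
Proof.
rewrite -sqrtr_sqr ler_wsqrtr// (bigD1 i)//= lerDl.
by apply: sumr_ge0 => j _; exact: sqr_ge0.
Qed.

Lemma hausdorff_dist_ge A B e :
  (forall r, 0 <= r -> A `<=` neighborhood B r -> B `<=` neighborhood A r ->
    e <= r) ->
  (e%:E <= hausdorff_dist A B)%E.
Proof.
move=> h; apply: le_ereal_inf_tmp => _ [r [r0 AB BA] <-].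
by rewrite lee_fin; exact: h.
Qed.

(** The Euclidean norm dominates each coordinate, so an [A] that avoids the cube
    of half-side [e] keeps the origin at distance more than [e]. *)
Lemma hausdorff_dist_ge_missed A B e : B 0 ->
  (forall y, cube (- e) e y -> ~ A y) -> (e%:E <= hausdorff_dist A B)%E.
Proof.
move=> B0 nA; apply: hausdorff_dist_ge => r r0 _ /(_ 0 B0)[y Ay].
move=> yr; rewrite leNgt; apply/negP => re; apply: (nA y _ Ay) => i.
rewrite -ler_norml; apply: le_trans (ltW re); apply: le_trans yr.
by have := coord_le_norm (0 - y) i; rewrite !mxE sub0r normrN.
Qed.

Lemma hausdorff_dist_ge_hit A B e y : A y -> cube (- e) e y ->
  (forall z, B z -> exists i, 2 * e <= z ord0 i) ->
  (e%:E <= hausdorff_dist A B)%E.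
Proof.
move=> Ay ye Be; apply: hausdorff_dist_ge => r r0 /(_ y Ay)[z Bz yz _].
have [i zi] := Be z Bz; apply: le_trans yz.
apply: le_trans (coord_le_norm _ i); rewrite !mxE.
by have := ye i; rewrite ler_normr; lra.
Qed.

End hausdorff.

Section risk.
Local Open Scope ereal_scope.
Context (R : realType) (d n : nat).

Lemma hausdorff_risk_ge (q e : R) (Kn : n.-tuple (borel_rV R d) -> set 'rV[R]_d)
    (K : convex_body R d) (A : set (n.-tuple (borel_rV R d))) :
  (0 <= q)%R -> (0 <= e)%R -> measurable A ->
  (forall x, A x -> e%:E <= hausdorff_dist (Kn x) K) ->
  (e `^ q)%:E * iid_uniform n K A <= hausdorff_risk q Kn K.
Proof.
move=> q0 e0 mA eK; apply: ge0_integral_ge => // [|x|x Ax].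
- exact: powR_ge0.
- exact: poweR_ge0.
rewrite -poweR_EFin; apply: gt0_ler_poweR => //.
- by rewrite in_itv/= lee_fin e0 leey.
- by rewrite in_itv/= leey andbT (le_trans _ (eK x Ax)).
- exact: eK.
Qed.

End risk.

(** * The cube with a corner cut off *)

Section cut_cube.
Context (R : realType) (d : nat).

Lemma closed_measurable_rV (A : set 'rV[R]_d) :
  closed A -> measurable (A : set (borel_rV R d)).
Proof.
move=> cA; rewrite -[A]setCK; apply: measurableC; apply: sub_sigma_algebra.
by rewrite openC.
Qed.

Lemma continuous_coord_sum : continuous (fun v : 'rV[R]_d => \sum_i v ord0 i).
Proof.
elim: (index_enum _) => [|i s IH] v.
  rewrite (_ : (fun _ => _) = cst 0); first exact: cst_continuous.
  by apply/funext => w; rewrite big_nil.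
rewrite (_ : (fun _ => _) = fun w : 'rV[R]_d => w ord0 i + \sum_(j <- s) w ord0 j).
  by apply: continuousD; [exact: coord_continuous|exact: IH].
by apply/funext => w; rewrite big_cons.
Qed.

Definition cut_cube (h a : R) : set 'rV[R]_d :=
  cube 0 a `&` [set v | h <= \sum_i v ord0 i].

Lemma cut_cube_compact h a : compact (cut_cube h a).
Proof.
apply: compact_closedI; first exact: compact_cube.
have /continuous_closedP := continuous_coord_sum.
by move=> /(_ _ (@closed_ge R h)).
Qed.

Lemma cut_cube_convex h a : convex_set (cut_cube h a).
Proof.
move=> x y l /[!inE] -[xa xh] [ya yh].
have l0 : 0 <= l%:num by [].
have l1 : l%:num <= 1 by [].
have E i : (conv l x y : 'rV[R]_d) ord0 i =
    l%:num * x ord0 i + (1 - l%:num) * y ord0 i.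
  by rewrite !mxE.
split=> [i|/=].
  have /andP[x0 x1] := xa i; have /andP[y0 y1] := ya i.
  by rewrite E; apply/andP; split; nra.
under eq_bigr do rewrite E.
rewrite big_split/= -!mulr_sumr; move: xh yh => /=; nra.
Qed.

Lemma cut_cube_interior h a : (0 < d)%N -> 0 <= h -> h < a ->
  (cut_cube h a)° !=set0.
Proof.
move=> d0 h0 ha.
exists (const_mx ((h + a) / 2)); apply/nbhs_ballP.
have r0 : 0 < (a - h) / 2 by lra.
exists ((a - h) / 2) => // v [_ vb].
have vi i : h < v ord0 i < a.
  have := vb ord0 i; rewrite mxE /ball/= ltr_distlC; lra.
split=> [i|/=]; first by have := vi i; lra.
rewrite (bigD1 (Ordinal d0))//= ler_wpDr//.
  by apply: sumr_ge0 => i _; have := vi i; lra.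
by have := vi (Ordinal d0); lra.
Qed.

Definition cut_cube_body h a (d0 : (0 < d)%N) (h0 : 0 <= h) (ha : h < a) :
    convex_body R d :=
  ConvexBody (@cut_cube_compact h a) (@cut_cube_convex h a)
    (cut_cube_interior d0 h0 ha).

End cut_cube.

Section cut_cube_theory.
Context (R : realType) (d : nat).

Lemma cut_cube0 a : @cut_cube R d 0 a = cube 0 a.
Proof.
apply/seteqP; split=> [v []//|v va]; split => //=.
by apply: sumr_ge0 => i _; have := va i; lra.
Qed.

Lemma cut_cube_large_coord h a (z : 'rV[R]_d) : (0 < d)%N ->
  cut_cube h a z -> exists i, h / d%:R <= z ord0 i.
Proof.
move=> d0 [_ /= hz]; apply: contrapT => /forallNP zh.
move: hz; apply/negP; rewrite -ltNge.
have -> : h = \sum_(i < d) (h / d%:R).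
  by rewrite sumr_const card_ord -[RHS]mulr_natr divfK// pnatr_eq0 -lt0n.
apply: ltr_sum => [|i _]; last by rewrite ltNge; apply/negP/zh.
by apply/hasP; exists (Ordinal d0); rewrite // mem_index_enum.
Qed.

Lemma cube_unit_ball : cube 0 d%:R^-1 `<=` @euclidean_unit_ball R d.
Proof.
move=> v vd; rewrite /euclidean_unit_ball/= /euclidean_norm.
rewrite -[leRHS]sqrtr1 ler_wsqrtr//.
case: (posnP d) => [d0|d0].
  rewrite big1// => i _; have := ltn_ord i; by rewrite {2}d0.
have dR : (0 : R) < d%:R by rewrite ltr0n.
have d1 : (1 : R) <= d%:R by rewrite ler1n.
apply: (@le_trans _ _ (\sum_(i < d) d%:R^-1)).
  apply: ler_sum => i _; have /andP[v0 v1] := vd i.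
  have v2 : v ord0 i <= 1 by apply: (le_trans v1); rewrite invf_le1.
  by apply: le_trans v1; rewrite expr2 ler_piMl.
by rewrite sumr_const card_ord -[leLHS]mulr_natr mulVf// gt_eqF.
Qed.

Local Open Scope ereal_scope.

(** The corner that is cut off consists of points with all coordinates at most
    [h], as their coordinates are nonnegative and sum to less than [h]. *)
Lemma lebesgue_cut_cube h a : (0 <= h)%R -> (0 <= a)%R ->
  (a ^+ d - h ^+ d)%:E <= lebesgue_rV (@cut_cube R d h a).
Proof.
move=> h0 a0; have mcube x y : measurable (cube x y : set (borel_rV R d)).
  apply: closed_measurable_rV; apply: compact_closed => //.
  exact: compact_cube.
have mcut : measurable (cut_cube h a : set (borel_rV R d)).
  apply: closed_measurable_rV; apply: compact_closed => //.
  exact: cut_cube_compact.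
rewrite EFinB leeBlDr// -!lebesgue_cube//.
apply: le_trans (measureU2 _ mcut (mcube _ _)).
apply: le_measure; rewrite ?inE//; first exact: measurableU.
move=> v va; have [hv|vh] := leP h (\sum_i v ord0 i)%R; [by left|right => i].
have := va i => /andP[v0 _]; rewrite v0/=; apply: le_trans (ltW vh).
rewrite (bigD1 i)//= lerDl; apply: sumr_ge0 => j _.
by have /andP[] := va j.
Qed.

End cut_cube_theory.

(** * Comparison of two bodies *)

Section uniform_law_theory.
Local Open Scope ereal_scope.
Context (R : realType) (d : nat).

Lemma uniform_lawE (K : convex_body R d) (A : set (borel_rV R d)) (m : R) :
  (0 < m)%R -> lebesgue_rV K = m%:E ->
  uniform_law K A = lebesgue_rV (A `&` K) * m^-1%:E.
Proof.
move=> m0 Km; rewrite /uniform_law/= /mnormalize/= /mrestr setTI Km/=.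
by rewrite eqe gt_eqF.
Qed.

(** Both laws are normalizations of the Lebesgue measure; passing from the larger
    body to the smaller one multiplies the density by at most 1/c. *)
Lemma le_uniform_law (K0 K1 : convex_body R d) (c m0 : R) :
  K1 `<=` K0 -> lebesgue_rV K0 = m0%:E -> (0 < c)%R -> (0 < m0)%R ->
  (c * m0)%:E <= lebesgue_rV K1 ->
  forall A, measurable A -> c%:E * uniform_law K1 A <= uniform_law K0 A.
Proof.
move=> K10 K0m c0 m00 cm A mA.
have mK (K : convex_body R d) : measurable (K : set (borel_rV R d)).
  exact: measurable_body.
have : lebesgue_rV K1 <= m0%:E by rewrite -K0m le_measure ?inE.
case K1m : (lebesgue_rV K1) cm => [m1| |]//; rewrite !lee_fin => cm _.
have m10 : (0 < m1)%R by apply: lt_le_trans cm; exact: mulr_gt0.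
rewrite (uniform_lawE _ m10 K1m) (uniform_lawE _ m00 K0m) muleCA.
apply: lee_pmul => //.
- by rewrite mule_ge0// lee_fin ltW// invr_gt0.
- apply: le_measure; rewrite ?inE; try exact: measurableI.
  exact: setIS.
- by rewrite -EFinM lee_fin ler_pdivrMr// ler_pdivlMl// mulrC.
Qed.

End uniform_law_theory.

Lemma bernoulli_ineq (R : realFieldType) (n : nat) (x : R) : 0 <= x <= 1 ->
  1 - n%:R * x <= (1 - x) ^+ n.
Proof.
move=> x01; elim: n => [|n IH]; first by rewrite expr0 mul0r subr0.
have n0 : 0 <= n%:R :> R by [].
have nx : 0 <= n%:R * x * x by rewrite !mulr_ge0//; lra.
rewrite exprS -natr1; apply: (@le_trans _ _ ((1 - x) * (1 - n%:R * x))).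
  by lra.
by apply: ler_wpM2l => //; lra.
Qed.

Section two_points.
Local Open Scope ereal_scope.
Context (R : realType) (d n : nat).

Lemma iid_uniform_total (K : convex_body R d) : iid_uniform n K setT = 1.
Proof. by apply: power_measure_total; exact: probability_setT. Qed.

Lemma le_iid_uniform (K0 K1 : convex_body R d) (m0 : R) : (0 < n)%N ->
  K1 `<=` K0 -> lebesgue_rV K0 = m0%:E -> (0 < m0)%R ->
  ((1 - (2 * n%:R)^-1) * m0)%:E <= lebesgue_rV K1 ->
  forall A, measurable A -> 2^-1%:E * iid_uniform n K1 A <= iid_uniform n K0 A.
Proof.
move=> n0 K10 K0m m00 cm A mA.
have nR : (1 <= n%:R :> R)%R by rewrite ler1n.
have n2 : (0 < (2 * n%:R : R)^-1 <= 2^-1)%R.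
  by rewrite invr_gt0 lef_pV2 ?posrE; lra.
have c0 : (0 < 1 - (2 * n%:R)^-1 :> R)%R by lra.
have := le_power_measure (ltW c0) (le_uniform_law K10 K0m c0 m00 cm) mA.
apply: le_trans; apply: lee_wpmul2r => //; rewrite lee_fin.
apply: le_trans (@bernoulli_ineq _ n (2 * n%:R)^-1 _); last by lra.
by rewrite invfM mulrCA divff ?gt_eqF//; lra.
Qed.

(** Le Cam's two-point method, for the test that accepts [K1] when the estimate
    meets [C].  The event that it does is only known to be a Souslin set; the
    capacitability dichotomy at the threshold 1/2 provides a measurable event on
    which the estimator is wrong, whose probability under [K1] is at least 1/2. *)
Lemma two_point_risk (K0 K1 : convex_body R d)
    (Kn : n.-tuple (borel_rV R d) -> set 'rV[R]_d) (C : set 'rV[R]_d) (q e : R) :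
  set_statistic Kn -> compact C -> (0 <= q)%R -> (0 <= e)%R ->
  (forall A, measurable A -> 2^-1%:E * iid_uniform n K1 A <= iid_uniform n K0 A) ->
  (forall x, (forall y, C y -> ~ Kn x y) -> e%:E <= hausdorff_dist (Kn x) K0) ->
  (forall x y, C y -> Kn x y -> e%:E <= hausdorff_dist (Kn x) K1) ->
  (e `^ q / 4)%:E <= hausdorff_risk q Kn K0 \/
  (e `^ q / 4)%:E <= hausdorff_risk q Kn K1.
Proof.
move=> [_ mKn] cC q0 e0 K01 missK0 hitK1.
have mE : measurable [set p : n.-tuple (borel_rV R d) * borel_rV R d | Kn p.1 p.2].
  rewrite [X in measurable X](_ : _ =
    [set: _] `&` (fun p => \1_(Kn p.1) p.2 : R) @^-1` [set 1%R]).
    exact: mKn.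
  rewrite setTI; apply/seteqP; split=> p /=; rewrite indicE.
    by move=> Kp; rewrite mem_set.
  case: (boolP (p.2 \in Kn p.1)) => [/[!inE]//|_ /eqP].
  by rewrite eq_sym oner_eq0.
have e4 : (e `^ q / 4)%:E = (e `^ q)%:E * (2^-1%:E * 2^-1%:E).
  by rewrite -!EFinM; congr (_ * _)%:E; rewrite -invfM -natrM.
have total := iid_uniform_total K1.
have eq0 : 0 <= (e `^ q)%:E by rewrite lee_fin powR_ge0.
have half0 : (0 : \bar R) <= 2^-1%:E by rewrite lee_fin.
have sE := @measurable_souslin _ (n.-tuple (borel_rV R d)) 'rV[R]_d _
  (@open_Fsigma R 'rV[R]_d) mE.
have [|[B [mB SB PB]]|[F [mF FS PF]]] := @souslin_capacitable _ _ _
    (iid_uniform n K1) _ 2^-1%:E _ (souslin_projection cC sE).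
- by rewrite total ltry.
- left.
  have half : 2^-1%:E <= iid_uniform n K1 (~` B).
    have : 1 <= iid_uniform n K1 B + iid_uniform n K1 (~` B).
      rewrite -total -(setUv B); apply: measureU2 => //; exact: measurableC.
    move: PB; case: (iid_uniform n K1 B) => [b| |]//.
    case: (iid_uniform n K1 (~` B)) => [b'| |] //.
    - by rewrite -EFinD !lee_fin; lra.
    - by move=> _ _; exact: leey.
  apply: (@le_trans _ _ ((e `^ q)%:E * iid_uniform n K0 (~` B))).
    rewrite e4; apply: lee_wpmul2l => //.
    by apply: le_trans (K01 _ (measurableC mB)); exact: lee_wpmul2l.
  apply: hausdorff_risk_ge => // [|x nBx]; first exact: measurableC.
  by apply: missK0 => y Cy Ky; apply/nBx/SB; exists y.
- right; apply: (@le_trans _ _ ((e `^ q)%:E * iid_uniform n K1 F)).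
    rewrite e4; apply: lee_wpmul2l => //; apply: le_trans PF.
    by rewrite -EFinM lee_fin; lra.
  by apply: hausdorff_risk_ge => // x /FS[y Cy Ky]; exact: hitK1 Cy Ky.
Qed.

End two_points.

Theorem theorem5 (R : realType) (d : nat) (hd : (0 < d)%N) (q : R) (hq : 1 <= q) :
  exists2 c : R, 0 < c & forall n : nat, (1 <= n)%N ->
    ((c * n%:R `^ (- (q / d%:R)))%:E <=
     ereal_inf [set ereal_sup [set hausdorff_risk q Kn K
                              | K in [set K : convex_body R d
                                     | (K : set 'rV[R]_d) `<=` @euclidean_unit_ball R d]]
               | Kn in @set_statistic R d n])%E.
Proof.
have dR : 0 < d%:R :> R by rewrite ltr0n.
have q0 : 0 <= q by lra.
(* The side a = 1/d makes the cube fit in the unit ball. *)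
pose a : R := d%:R^-1; have a0 : 0 < a by rewrite invr_gt0.
pose k : R := a * 2 `^ (- a) / d%:R / 2.
have k0 : 0 < k by rewrite !divr_gt0// mulr_gt0// powR_gt0.
exists (k `^ q / 4) => [|n n1]; first by rewrite divr_gt0// powR_gt0.
have n0 : 1 <= n%:R :> R by rewrite ler1n.
(* As a = 1/d, the ratio t of the cut to the side satisfies t^d = 1/(2n). *)
pose t : R := (2 * n%:R) `^ (- a).
have t0 : 0 < t by rewrite powR_gt0; lra.
have td : t ^+ d = (2 * n%:R)^-1.
  rewrite -powR_mulrn ?ltW// -powRrM mulNr mulVf ?gt_eqF// powR_inv1//; lra.
have t1 : t < 1.
  rewrite -(@ltr_pXn2r _ d)// ?nnegrE//; last exact: ltW.
  by rewrite td expr1n invf_lt1; lra.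
have h0 : 0 <= a * t by rewrite mulr_ge0// ltW.
have ha : a * t < a by rewrite gtr_pMr.
pose K0 := @cut_cube_body R d 0 a hd (lexx 0) a0.
pose K1 := cut_cube_body hd h0 ha.
have K0E : (K0 : set 'rV[R]_d) = cube 0 a by exact: cut_cube0.
have K10 : K1 `<=` K0 by rewrite K0E => v [].
have K0ball : K0 `<=` @euclidean_unit_ball R d by rewrite K0E; exact: cube_unit_ball.
(* K1 has no point with all coordinates below h/d = 2e, where h = a t. *)
pose e : R := a * t / d%:R / 2.
have e0 : 0 <= e by rewrite !divr_ge0// ltW.
have -> : k `^ q / 4 * n%:R `^ (- (q / d%:R)) = e `^ q / 4.
  rewrite mulrAC; congr (_ / _).
  have -> : e = k * n%:R `^ (- a).
    by rewrite /e /k /t powRM; [ring|lra|lra].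
  by rewrite powRM ?powR_ge0 ?(ltW k0)// -powRrM mulNr (mulrC a q).
apply: le_ereal_inf_tmp => _ [Kn sKn <-].
have [|||riskK|riskK] := @two_point_risk R d n K0 K1 Kn (cube (- e) e) q e sKn
    (@compact_cube R d _ _) q0 e0.
- apply: (@le_iid_uniform _ _ _ _ _ (a ^+ d)) => //.
  + by rewrite K0E lebesgue_cube// ltW.
  + exact: exprn_gt0.
  + apply: le_trans (lebesgue_cut_cube d h0 (ltW a0)).
    by rewrite lee_fin exprMn td; lra.
- move=> x; apply: hausdorff_dist_ge_missed.
  by rewrite K0E => i; rewrite mxE lexx ltW.
- move=> x y ye xy; apply: hausdorff_dist_ge_hit xy ye _ => z.
  move=> /(cut_cube_large_coord hd)[i zi]; exists i; apply: le_trans zi.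
  by rewrite /e; lra.
- by apply: le_trans riskK _; apply: ereal_sup_ubound; exists K0.
- apply: le_trans riskK _; apply: ereal_sup_ubound; exists K1 => //.
  exact: subset_trans K0ball.
Qed.
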